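(* Let $n\geq 2$ be an integer, and for integers $j\ge 0$ and $x\in[0,1)$ let $$f_{n,j}(x):=\sum_{k=0}^{\infty}\binom{n+k}{k}\frac{1}{(n+k)^j}x^k.$$ For each integer $j\geq 2$, the function $x\mapsto x^nf_{n,j}(x)$ on $[0,1)$ is a linear combination, with constant coefficients, of $n$ functions as follows: 1) for $2\leq j\leq n$: the functions $\dfrac{1-(1-x)^i}{(1-x)^i}$, $i=1,\dots,n-j+1$; $\log(1-x)$; $Li_2(x),\dots,Li_{j-1}(x)$; 2) for $j=n+1$: the functions $\log(1-x)$; $Li_2(x),\dots,Li_n(x)$; 3) for $j\geq n+2$: the functions $Li_{j-n}(x),\dots,Li_{j-1}(x)$.
   Context: The polylogarithm of order $s\ge 2$ is $Li_s(x)=\sum_{k=1}^\infty \frac{x^k}{k^s}$ for $|x|\le 1$; equivalently $Li_2(x)=-\int_0^x\frac{\log(1-t)}{t}dt$ and $Li_s(x)=\int_0^x\frac{Li_{s-1}(t)}{t}dt$ for $s\ge 3$. For $j=2$ the list $Li_2(x),\dots,Li_{j-1}(x)$ is empty. The constant coefficients may depend on $n$ and $j$ but not on $x$. *)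

(* Defs.v *)
From Stdlib Require Import Reals List.
From Coquelicot Require Import Coquelicot.
Import ListNotations.
Open Scope R_scope.

(* [Series] is total; the series below converge for [0 <= x < 1].
   [Binomial.C] is the real-valued binomial coefficient ([C] alone would be
   Coquelicot's type of complex numbers). *)
Definition binom_polylog_sum (n j : nat) (x : R) : R :=
  Series (fun k : nat =>
    Binomial.C (n + k) k * (1 / INR (n + k) ^ j) * x ^ k).

(* Index shifted by one: the sum runs over exponents [k + 1 >= 1]. *)
Definition Li (s : nat) (x : R) : R :=
  Series (fun k : nat => x ^ (k + 1) / INR (k + 1) ^ s).

Definition is_linear_combination_on (D : R -> Prop)
    (fs : list (R -> R)) (g : R -> R) : Prop :=
  exists c : nat -> R, forall x : R, D x ->
    g x = fold_right Rplus 0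
            (map (fun i : nat => c i * nth i fs (fun _ => 0) x)
                 (seq 0 (length fs))).

Definition Ico01 (x : R) : Prop := 0 <= x < 1.

(* [seq a m] lists the [m] consecutive integers starting at [a]. *)
Definition pole_functions (m : nat) : list (R -> R) :=
  map (fun (i : nat) (x : R) => (1 - (1 - x) ^ i) / (1 - x) ^ i) (seq 1 m).

Definition log_function : R -> R := fun x => ln (1 - x).

Definition polylogs (a m : nat) : list (R -> R) := map Li (seq a m).

Definition functions_low (n j : nat) : list (R -> R) :=
  pole_functions (n - j + 1) ++ [log_function] ++ polylogs 2 (j - 2).

Definition functions_mid (n : nat) : list (R -> R) :=
  log_function :: polylogs 2 (n - 1).

Definition functions_high (n j : nat) : list (R -> R) :=
  polylogs (j - n) n.

(* Main.v *)
Require Import Defs.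
From Stdlib Require Import Reals Factorial List Lra Lia.
From Coquelicot Require Import Coquelicot.
Open Scope R_scope.

(** Put [m = n + k]: the function is the sum over [m >= 1] of
    [binom(m, n) / m^j * x^m], the terms with [0 < m < n] being zero.  As a
    function of [m], [binom(m, n)] is a polynomial of degree [n] without constant
    term, so the function is a combination of the sums of [m^(i-j) x^m] for
    [1 <= i <= n].  For [i < j] these are [Li_(j-i)], with [Li_1 = -log(1-x)].
    For [i >= j], expand [m^(i-j)] in the rising factorials
    [(m+1)...(m+p-1) / (p-1)!], whose generating functions over [m >= 1] are
    [(1-x)^(-p) - 1]. *)

(** * Power series on the open unit disk *)

(** The whole disk is used rather than [[0, 1)], so that sums can be differentiated at every point,
    including 0. *)
Definition generates (a : nat -> R) (g : R -> R) : Prop :=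
  forall x, Rabs x < 1 -> is_series (fun m => a m * x ^ m) (g x).

Lemma generates_ext (a b : nat -> R) (f g : R -> R) :
  (forall m, a m = b m) -> (forall x, Rabs x < 1 -> f x = g x) ->
  generates a f -> generates b g.
Proof.
  intros Hab Hfg Ha x Hx. rewrite <- (Hfg x Hx).
  apply is_series_ext with (2 := Ha x Hx).
  intros m; simpl; now rewrite Hab.
Qed.

Lemma generates_lin (a b : nat -> R) (f g : R -> R) (c d : R) :
  generates a f -> generates b g ->
  generates (fun m => c * a m + d * b m) (fun x => c * f x + d * g x).
Proof.
  intros Ha Hb x Hx.
  pose proof (is_series_plus _ _ _ _
    (is_series_scal c _ _ (Ha x Hx)) (is_series_scal d _ _ (Hb x Hx))) as H.
  apply is_series_ext with (2 := H).
  intros m; unfold plus, scal; simpl; unfold mult; simpl; ring.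
Qed.

(** The midpoint [y] of [Rabs x] and 1 cannot lie beyond the radius: the series converges at [y], so
    its terms tend to 0 there. *)
Lemma generates_CV_radius (a : nat -> R) (g : R -> R) (x : R) :
  generates a g -> Rabs x < 1 -> Rbar_lt (Rabs x) (CV_radius a).
Proof.
  intros Ha Hx.
  set (y := (Rabs x + 1) / 2).
  assert (Hx0 := Rabs_pos x).
  assert (Hy : Rabs y = y) by (apply Rabs_pos_eq; unfold y; lra).
  assert (Hle : Rbar_le (Rabs y) (CV_radius a)).
  { apply Rbar_not_lt_le. intros H.
    apply (CV_disk_outside _ _ H), ex_series_lim_0.
    exists (g y). apply Ha. rewrite Hy; unfold y; lra. }
  apply Rbar_lt_le_trans with (2 := Hle). rewrite Hy; simpl; unfold y; lra.
Qed.

Lemma generates_PSeries (a : nat -> R) (g : R -> R) (x : R) :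
  generates a g -> Rabs x < 1 -> PSeries a x = g x.
Proof.
  intros Ha Hx. apply is_pseries_unique, is_pseries_R, Ha, Hx.
Qed.

Lemma locally_unit_disk (x : R) : Rabs x < 1 -> locally x (fun y => Rabs y < 1).
Proof.
  intros Hx.
  assert (Hd : 0 < 1 - Rabs x) by lra.
  exists (mkposreal _ Hd). intros y Hy.
  change (Rabs (y - x) < 1 - Rabs x) in Hy.
  pose proof (Rabs_triang x (y - x)) as Ht.
  rewrite Rplus_minus in Ht. lra.
Qed.

(** Termwise differentiation inside the radius of convergence, followed by multiplication by [x]. *)
Lemma generates_euler (a : nat -> R) (g g' : R -> R) :
  generates a g -> (forall x, Rabs x < 1 -> is_derive g x (g' x)) ->
  generates (fun m => INR m * a m) (fun x => x * g' x).
Proof.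
  intros Ha Hg x Hx.
  assert (HD : Derive (PSeries a) x = g' x).
  { apply is_derive_unique, (is_derive_ext_loc g); [|now apply Hg].
    apply (filter_imp (fun y => Rabs y < 1)); [|now apply locally_unit_disk].
    intros y Hy; symmetry; now apply generates_PSeries. }
  pose proof (is_pseries_derive a x (generates_CV_radius a g x Ha Hx)) as H.
  rewrite HD in H. apply is_pseries_R in H.
  (* The term of index 0 vanishes; dropping it aligns the indices with [PS_derive]. *)
  apply is_series_decr_1.
  replace (plus _ _) with (x * g' x)
    by (unfold plus, opp; simpl; ring).
  apply is_series_ext with (2 := is_series_scal x _ _ H).
  intros m. unfold scal; simpl; unfold mult; simpl.
  unfold PS_derive. change (match m with 0%nat => 1 | S _ => INR m + 1 end) with (INR (S m)).
  ring.
Qed.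

(** * Inverse powers, polylogarithms and the logarithm *)

(** [m^(-s)] for [m >= 1], and [0] for [m = 0], also when [s = 0]. *)
Definition neg_power (s m : nat) : R := INR m / INR m ^ S s.

Lemma neg_power_0 (s : nat) : neg_power s 0 = 0.
Proof. unfold neg_power; simpl INR; unfold Rdiv; ring. Qed.

Lemma neg_power_S (s m : nat) : neg_power s (S m) = / INR (S m) ^ s.
Proof.
  unfold neg_power. pose proof (not_0_INR (S m) ltac:(lia)) as H.
  pose proof (pow_nonzero _ s H) as Hs.
  rewrite <- tech_pow_Rmult.
  generalize dependent (INR (S m) ^ s). generalize dependent (INR (S m)).
  intros t Ht u Hu. field. now split.
Qed.

Lemma pow_neg_power_le (i j m : nat) :
  (i <= j)%nat -> INR m ^ i * neg_power j m = neg_power (j - i) m.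
Proof.
  intros Hij. destruct m as [|m]; [rewrite !neg_power_0; ring|].
  rewrite !neg_power_S. pose proof (not_0_INR (S m) ltac:(lia)) as H.
  replace j with (i + (j - i))%nat at 1 by lia. rewrite pow_add.
  field. split; now apply pow_nonzero.
Qed.

(** The factor [neg_power 0 m] is the indicator of [m >= 1]; it is needed at [m = 0] when [i = j],
    as [0 ^ 0 = 1]. *)
Lemma pow_neg_power_ge (i j m : nat) :
  (j <= i)%nat -> INR m ^ i * neg_power j m = INR m ^ (i - j) * neg_power 0 m.
Proof.
  intros Hij. destruct m as [|m]; [rewrite !neg_power_0; ring|].
  rewrite !neg_power_S. pose proof (not_0_INR (S m) ltac:(lia)) as H.
  replace i with (j + (i - j))%nat at 1 by lia. rewrite pow_add.
  simpl (INR (S m) ^ 0). field. now apply pow_nonzero.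
Qed.

(** Convergence holds by comparison with the geometric series of [Rabs x], since
    [1 / (k + 1)^s <= 1]. *)
Lemma generates_Li (s : nat) : generates (neg_power s) (Li s).
Proof.
  intros x Hx. apply is_series_decr_1. rewrite neg_power_0.
  replace (plus _ _) with (Li s x) by (unfold plus, opp; simpl; ring).
  apply is_series_ext with (fun k => x ^ (k + 1) / INR (k + 1) ^ s).
  { intros k. rewrite Nat.add_1_r, neg_power_S. unfold Rdiv; apply Rmult_comm. }
  apply Series_correct.
  apply (ex_series_le (V := R_CompleteNormedModule) _ (fun k => Rabs x ^ k)).
  2:{ exists (/ (1 - Rabs x)). apply is_series_geom. now rewrite Rabs_Rabsolu. }
  intros k. rewrite Nat.add_1_r.
  change (Rabs (x ^ S k / INR (S k) ^ s) <= Rabs x ^ k).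
  assert (H1 : 1 <= INR (S k) ^ s).
  { apply pow_R1_Rle. rewrite S_INR. pose proof (pos_INR k); lra. }
  unfold Rdiv. rewrite !Rabs_mult, <- RPow_abs, (Rabs_pos_eq (/ _)).
  2:{ apply Rlt_le, Rinv_0_lt_compat; lra. }
  assert (H2 : / INR (S k) ^ s <= 1).
  { rewrite <- Rinv_1. apply Rinv_le_contravar; lra. }
  assert (H3 : 0 <= / INR (S k) ^ s) by (apply Rlt_le, Rinv_0_lt_compat; lra).
  pose proof (Rabs_pos x) as Hx0. pose proof (pow_le (Rabs x) k Hx0) as Hp.
  rewrite <- tech_pow_Rmult.
  assert (0 <= Rabs x * Rabs x ^ k <= Rabs x ^ k) by (split; nra).
  generalize dependent (/ INR (S k) ^ s). intros u Hu1 Hu0. nra.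
Qed.

Lemma Rabs_lt_1_minus_pos (x : R) : Rabs x < 1 -> 0 < 1 - x.
Proof. intros H; apply Rabs_def2 in H; lra. Qed.

(** The sum of [Li 1] and [ln (1 - x)] vanishes at 0 and has derivative 0, because the termwise
    derivative of [Li 1] is the geometric series. *)
Lemma generates_log : generates (neg_power 1) (fun x => - ln (1 - x)).
Proof.
  apply (generates_ext (neg_power 1) _ (Li 1)); [reflexivity| |apply generates_Li].
  assert (Hder : forall x, Rabs x < 1 ->
    is_derive (fun y => PSeries (neg_power 1) y + ln (1 - y)) x zero).
  { intros x Hx. pose proof (Rabs_lt_1_minus_pos x Hx) as Hpos.
    assert (HD : PSeries (PS_derive (neg_power 1)) x = / (1 - x)).
    { apply is_pseries_unique, is_pseries_R.
      apply is_series_ext with (2 := is_series_geom x Hx).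
      intros m. unfold PS_derive. rewrite neg_power_S.
      pose proof (not_0_INR (S m) ltac:(lia)) as H.
      rewrite pow_1, Rinv_r; [symmetry; apply Rmult_1_l | exact H]. }
    change (is_derive (fun y => PSeries (neg_power 1) y + ln (1 - y)) x 0).
    rewrite <- (Rplus_opp_r (/ (1 - x))).
    apply (is_derive_plus (V := R_NormedModule) (PSeries (neg_power 1))).
    - rewrite <- HD. apply is_derive_PSeries.
      now apply generates_CV_radius with (Li 1), Hx; apply generates_Li.
    - auto_derive; [exact Hpos | field; lra]. }
  intros x Hx.
  rewrite <- (generates_PSeries _ _ x (generates_Li 1) Hx).
  assert (H0 : PSeries (neg_power 1) 0 + ln (1 - 0) = 0).
  { rewrite PSeries_0, neg_power_0, Rminus_0_r, ln_1. ring. }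
  assert (Hconst : PSeries (neg_power 1) x + ln (1 - x) =
                   PSeries (neg_power 1) 0 + ln (1 - 0)).
  { apply Rabs_def2 in Hx.
    (* [eq_is_derive] takes the smaller endpoint first, hence the split on the sign of [x]. *)
    destruct (Rtotal_order x 0) as [Hlt | [-> | Hgt]]; [|reflexivity|].
    - apply (eq_is_derive (fun y => PSeries (neg_power 1) y + ln (1 - y)) x 0);
        [|exact Hlt].
      intros t Ht; apply Hder, Rabs_def1; lra.
    - symmetry.
      apply (eq_is_derive (fun y => PSeries (neg_power 1) y + ln (1 - y)) 0 x);
        [|exact Hgt].
      intros t Ht; apply Hder, Rabs_def1; lra. }
  lra.
Qed.

(** * Rising factorials and poles at 1 *)

(** This is [(m+1)...(m+p) / p!], the binomial coefficient of [m + p] over [p]. *)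
Fixpoint rising (p m : nat) : R :=
  match p with
  | O => 1
  | S q => rising q m * (INR m + INR p) / INR p
  end.

Definition pole (i : nat) (x : R) : R := (1 - (1 - x) ^ i) / (1 - x) ^ i.

Lemma pole_inv (i : nat) (x : R) : Rabs x < 1 -> pole i x = / (1 - x) ^ i - 1.
Proof.
  intros Hx. pose proof (Rabs_lt_1_minus_pos x Hx).
  unfold pole. field. apply pow_nonzero. lra.
Qed.

(* Applying [x d/dx] multiplies the [m]-th coefficient by [m], and
   [x pole_i'(x) = i (pole_(i+1)(x) - pole_i(x))]. *)
Lemma generates_pole (p : nat) :
  generates (fun m => rising p m * neg_power 0 m) (pole (S p)).
Proof.
  induction p as [|p IH].
  - intros x Hx. pose proof (Rabs_lt_1_minus_pos x Hx) as Hpos.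
    apply is_series_decr_1. rewrite neg_power_0.
    apply is_series_ext with (fun m => x * x ^ m).
    { intros m. rewrite neg_power_S.
      change (x * x ^ m = 1 * / 1 * (x * x ^ m)). field. }
    replace (plus _ _) with (x * / (1 - x)).
    + apply (is_series_scal x _ _ (is_series_geom x Hx)).
    + unfold plus, opp, pole; simpl. field. lra.
  - assert (Hg : forall x, Rabs x < 1 ->
      is_derive (pole (S p)) x (INR (S p) / (1 - x) ^ S (S p))).
    { intros x Hx. pose proof (Rabs_lt_1_minus_pos x Hx) as Hpos.
      pose proof (pow_nonzero (1 - x) p ltac:(lra)) as Hp.
      apply (is_derive_ext_loc (fun y => / (1 - y) ^ S p - 1)).
      - apply (filter_imp (fun y => Rabs y < 1)); [|now apply locally_unit_disk].
        intros y Hy. symmetry. now apply pole_inv.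
      - auto_derive; change (Nat.pred (S p)) with p.
        + simpl. apply Rmult_integral_contrapositive; split; [lra | exact Hp].
        + change (match p with 0%nat => 1 | S _ => INR p + 1 end) with (INR (S p)).
          change (1 + - x) with (1 - x). simpl pow.
          generalize dependent ((1 - x) ^ p). generalize (INR (S p)).
          intros t u Hu. field. split; [exact Hu | lra]. }
    (* The weights come from [rising (S p) m = rising p m * (1 + m / (p + 1))]. *)
    pose proof (generates_lin _ _ _ _ 1 (/ INR (S p)) IH (generates_euler _ _ _ IH Hg)) as H.
    pose proof (not_0_INR (S p) ltac:(lia)) as Hn.
    apply generates_ext with (3 := H).
    + intros m. change (rising (S p) m) with (rising p m * (INR m + INR (S p)) / INR (S p)).
      set (t := INR (S p)) in *. field. exact Hn.
    + intros x Hx. pose proof (Rabs_lt_1_minus_pos x Hx) as Hpos.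
      pose proof (pow_nonzero (1 - x) p ltac:(lra)) as Hp.
      unfold pole. set (t := INR (S p)) in *. simpl pow. field.
      repeat split; try assumption; lra.
Qed.

(** * Linear combinations and spans *)

Definition lin_sum (fs : list (R -> R)) (c : nat -> R) (x : R) (l : list nat) : R :=
  fold_right Rplus 0 (map (fun i => c i * nth i fs (fun _ => 0) x) l).

Lemma lin_comb_lin (fs : list (R -> R)) (f g : R -> R) (a b : R) :
  is_linear_combination_on Ico01 fs f -> is_linear_combination_on Ico01 fs g ->
  is_linear_combination_on Ico01 fs (fun x => a * f x + b * g x).
Proof.
  intros [c Hc] [d Hd]. exists (fun i => a * c i + b * d i). intros x Hx.
  rewrite (Hc x Hx), (Hd x Hx). clear Hc Hd.
  induction (seq 0 (length fs)) as [|i l IH]; simpl; [ring|].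
  rewrite <- IH. ring.
Qed.

Lemma lin_comb_nth (fs : list (R -> R)) (k : nat) :
  (k < length fs)%nat ->
  is_linear_combination_on Ico01 fs (nth k fs (fun _ => 0)).
Proof.
  intros Hk. exists (fun i => if Nat.eqb i k then 1 else 0). intros x _.
  (* With Kronecker delta coefficients, the sum is computed for every starting index [a], since
     unfolding [seq] shifts it. *)
  assert (H : forall m a, lin_sum fs (fun i => if Nat.eqb i k then 1 else 0) x (seq a m)
     = if andb (Nat.leb a k) (Nat.ltb k (a + m)) then nth k fs (fun _ => 0) x else 0).
  { induction m as [|m IH]; intros a.
    - simpl. destruct (Nat.leb_spec a k), (Nat.ltb_spec k (a + 0)); simpl; try reflexivity; lia.
    - change (lin_sum fs (fun i => if Nat.eqb i k then 1 else 0) x (seq a (S m)))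
        with ((if Nat.eqb a k then 1 else 0) * nth a fs (fun _ => 0) x
          + lin_sum fs (fun i => if Nat.eqb i k then 1 else 0) x (seq (S a) m)).
      rewrite IH.
      destruct (Nat.eqb_spec a k) as [->|Hne];
        repeat match goal with
        | |- context [Nat.leb ?u ?v] => destruct (Nat.leb_spec u v)
        | |- context [Nat.ltb ?u ?v] => destruct (Nat.ltb_spec u v)
        end; simpl; try lia; ring. }
  specialize (H (length fs) 0%nat). unfold lin_sum in H. rewrite H.
  simpl. destruct (Nat.ltb_spec k (length fs)); [reflexivity | lia].
Qed.

Lemma lin_comb_In (fs : list (R -> R)) (f : R -> R) :
  In f fs -> is_linear_combination_on Ico01 fs f.
Proof.
  intros H. destruct (In_nth _ _ (fun _ => 0) H) as [k [Hk <-]].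
  now apply lin_comb_nth.
Qed.

(** Hiding the sum [g] lets the later recursions be carried out on coefficients alone. *)
Definition generates_in_span (fs : list (R -> R)) (a : nat -> R) : Prop :=
  exists g, is_linear_combination_on Ico01 fs g /\ generates a g.

Lemma in_span_lin (fs : list (R -> R)) (a b u : nat -> R) (c d : R) :
  (forall m, u m = c * a m + d * b m) ->
  generates_in_span fs a -> generates_in_span fs b -> generates_in_span fs u.
Proof.
  intros Hu [f [Hf Ha]] [g [Hg Hb]].
  exists (fun x => c * f x + d * g x). split; [now apply lin_comb_lin|].
  apply generates_ext with (3 := generates_lin _ _ _ _ c d Ha Hb); auto.
Qed.

Lemma in_span_ext (fs : list (R -> R)) (a b : nat -> R) :
  (forall m, a m = b m) -> generates_in_span fs a -> generates_in_span fs b.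
Proof.
  intros H Ha. apply (in_span_lin fs a a b 1 0); auto.
  intros m; rewrite H; ring.
Qed.

(** Since [m * rising p m = (p + 1) * (rising (S p) m - rising p m)], each factor [m] raises the
    pole order by at most one. *)
Lemma in_span_poles (fs : list (R -> R)) (N : nat) :
  (forall i, (1 <= i <= N)%nat -> In (pole i) fs) ->
  forall r p, (S p + r <= N)%nat ->
    generates_in_span fs (fun m => INR m ^ r * (rising p m * neg_power 0 m)).
Proof.
  intros HN. induction r as [|r IH]; intros p Hp.
  - exists (pole (S p)). split; [apply lin_comb_In, HN; lia|].
    apply generates_ext with (3 := generates_pole p); [intros m; simpl; ring | auto].
  - apply (in_span_lin fs _ _ _ (INR (S p)) (- INR (S p)))
      with (2 := IH (S p) ltac:(lia)) (3 := IH p ltac:(lia)).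
    intros m. change (rising (S p) m) with (rising p m * (INR m + INR (S p)) / INR (S p)).
    pose proof (not_0_INR (S p) ltac:(lia)) as Hn.
    set (t := INR (S p)) in *. simpl pow. field. exact Hn.
Qed.

(** * Falling factorials and the binomial coefficient *)

(** [(m-1)(m-2)...(m-p)], so that [binom(m, n) = m * falling (n-1) m / n!]. *)
Fixpoint falling (p m : nat) : R :=
  match p with
  | O => 1
  | S q => falling q m * (INR m - INR p)
  end.

Lemma falling_small (p m : nat) : (1 <= m <= p)%nat -> falling p m = 0.
Proof.
  induction p as [|p IH]; intros Hm; [lia|].
  cbn [falling]. destruct (Nat.eq_dec m (S p)) as [->|Hne].
  - ring.
  - rewrite IH by lia. ring.
Qed.

(** In the induction the new factor [m - (p + 1)] equals [k + 1], which turns [k!] into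
    [(k + 1)!]. *)
Lemma falling_fact (p k : nat) :
  INR (S p + k) * falling p (S p + k) * INR (fact k) = INR (fact (S p + k)).
Proof.
  revert k. induction p as [|p IH]; intros k.
  - simpl falling. change (1 + k)%nat with (S k).
    rewrite fact_simpl, mult_INR. ring.
  - specialize (IH (S k)).
    replace (S p + S k)%nat with (S (S p) + k)%nat in IH by lia.
    rewrite <- IH, fact_simpl, mult_INR. cbn [falling].
    replace (INR (S (S p) + k) - INR (S p)) with (INR (S k)); [ring|].
    replace (S (S p) + k)%nat with (S k + S p)%nat by lia.
    rewrite (plus_INR (S k) (S p)). ring.
Qed.

(** Expanding the last factor [m - (p + 1)] either raises the exponent [i] by one or keeps it, so
    only exponents from 1 to [n] occur. *)
Lemma in_span_falling (fs : list (R -> R)) (n j : nat) :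
  (forall i, (1 <= i <= n)%nat ->
     generates_in_span fs (fun m => INR m ^ i * neg_power j m)) ->
  forall p i, (1 <= i)%nat -> (i + p <= n)%nat ->
    generates_in_span fs (fun m => falling p m * (INR m ^ i * neg_power j m)).
Proof.
  intros Hpow. induction p as [|p IH]; intros i Hi Hn.
  - apply (in_span_ext fs (fun m => INR m ^ i * neg_power j m)).
    + intros m; simpl; ring.
    + apply Hpow; lia.
  - apply (in_span_lin fs _ _ _ 1 (- INR (S p)))
      with (2 := IH (S i) ltac:(lia) ltac:(lia)) (3 := IH i ltac:(lia) ltac:(lia)).
    intros m. cbn [falling pow]. ring.
Qed.

Lemma binom_polylog_sum_generated (n j : nat) (g : R -> R) (x : R) :
  (1 <= n)%nat -> Ico01 x ->
  generates (fun m => falling (n - 1) m * (INR m ^ 1 * neg_power j m)) g ->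
  x ^ n * binom_polylog_sum n j x = / INR (fact n) * g x.
Proof.
  intros Hn Hx Hg.
  assert (Hx1 : Rabs x < 1) by (apply Rabs_def1; unfold Ico01 in Hx; lra).
  specialize (Hg x Hx1). cbv beta in Hg.
  rewrite <- (is_series_unique _ _ Hg).
  rewrite (Series_incr_n _ n) by (try lia; eexists; exact Hg).
  (* The first [n] terms vanish: [neg_power] is zero at [m = 0], [falling] at [0 < m < n]. *)
  rewrite sum_eq_R0.
  2:{ intros m Hm. destruct m as [|m]; [rewrite neg_power_0; ring|].
      rewrite falling_small by lia. ring. }
  unfold binom_polylog_sum. rewrite Rplus_0_l, <- !Series_scal_l.
  apply Series_ext. intros k.
  destruct n as [|p]; [lia|]. replace (S p - 1)%nat with p by lia.
  unfold Binomial.C. replace (S p + k - k)%nat with (S p) by lia.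
  rewrite <- falling_fact, pow_add.
  pose proof (INR_fact_neq_0 k). pose proof (INR_fact_neq_0 (S p)).
  change (S p + k)%nat with (S (p + k)). rewrite neg_power_S.
  pose proof (pow_nonzero _ j (not_0_INR (S (p + k)) ltac:(lia))).
  set (t := INR (S (p + k))) in *. set (u := INR (fact (S p))) in *.
  field. auto.
Qed.

(** This reduces each case of the theorem to placing the [n] sums of [m^(i-j) x^m] in the span. *)
Lemma binom_polylog_sum_span (fs : list (R -> R)) (n j : nat) :
  (1 <= n)%nat ->
  (forall i, (1 <= i <= n)%nat ->
     generates_in_span fs (fun m => INR m ^ i * neg_power j m)) ->
  is_linear_combination_on Ico01 fs (fun x => x ^ n * binom_polylog_sum n j x).
Proof.
  intros Hn Hpow.
  destruct (in_span_falling fs n j Hpow (n - 1) 1 ltac:(lia) ltac:(lia))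
    as [g [Hfg Hg]].
  (* A scalar multiple, obtained as a combination whose second weight is 0. *)
  destruct (lin_comb_lin fs g g (/ INR (fact n)) 0 Hfg Hfg) as [c Hc].
  exists c. intros x Hx. rewrite <- (Hc x Hx).
  rewrite (binom_polylog_sum_generated n j g x Hn Hx Hg). ring.
Qed.

(** * Matching each exponent with a listed function *)

Lemma in_span_Li (fs : list (R -> R)) (s i j : nat) :
  (i <= j)%nat -> s = (j - i)%nat -> In (Li s) fs ->
  generates_in_span fs (fun m => INR m ^ i * neg_power j m).
Proof.
  intros Hij -> Hin. exists (Li (j - i)). split; [now apply lin_comb_In|].
  apply generates_ext with (3 := generates_Li (j - i)); [|auto].
  intros m; symmetry; now apply pow_neg_power_le.
Qed.

Lemma in_span_log (fs : list (R -> R)) (i j : nat) :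
  j = S i -> In log_function fs ->
  generates_in_span fs (fun m => INR m ^ i * neg_power j m).
Proof.
  intros -> Hin. exists (fun x => -1 * log_function x + 0 * log_function x). split.
  - apply lin_comb_lin; now apply lin_comb_In.
  - apply generates_ext with (3 := generates_log).
    + intros m. rewrite pow_neg_power_le by lia. f_equal. lia.
    + intros x _. unfold log_function. ring.
Qed.

Lemma In_polylogs (a m s : nat) :
  (a <= s < a + m)%nat -> In (Li s) (polylogs a m).
Proof. intros H. apply in_map, in_seq, H. Qed.

Lemma In_pole_functions (m i : nat) :
  (1 <= i <= m)%nat -> In (pole i) (pole_functions m).
Proof.
  intros H. unfold pole_functions.
  apply (in_map (fun (k : nat) (x : R) => (1 - (1 - x) ^ k) / (1 - x) ^ k)).
  apply in_seq. lia.
Qed.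

Theorem theorem6p1 (n j : nat) (hn : (2 <= n)%nat) (hj : (2 <= j)%nat) :
  ((j <= n)%nat ->
     length (functions_low n j) = n /\
     is_linear_combination_on Ico01 (functions_low n j)
       (fun x => x ^ n * binom_polylog_sum n j x)) /\
  (j = (n + 1)%nat ->
     length (functions_mid n) = n /\
     is_linear_combination_on Ico01 (functions_mid n)
       (fun x => x ^ n * binom_polylog_sum n j x)) /\
  ((n + 2 <= j)%nat ->
     length (functions_high n j) = n /\
     is_linear_combination_on Ico01 (functions_high n j)
       (fun x => x ^ n * binom_polylog_sum n j x)).
Proof.
  split; [|split].
  - intros Hjn. split.
    { unfold functions_low, pole_functions, polylogs.
      rewrite !length_app, !length_map, !length_seq. simpl. lia. }
    apply binom_polylog_sum_span; [lia|]. intros i Hi.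
    destruct (Nat.le_gt_cases j i) as [Hji|Hij].
    (* Nonnegative exponents [i - j <= n - j] give poles of order at most [n - j + 1]. *)
    + apply (in_span_ext _ (fun m => INR m ^ (i - j) * (rising 0 m * neg_power 0 m))).
      { intros m. rewrite (pow_neg_power_ge i j m Hji). simpl rising. ring. }
      apply in_span_poles with (n - j + 1)%nat; [|lia].
      intros k Hk. apply in_or_app. left. now apply In_pole_functions.
    + destruct (Nat.eq_dec j (S i)) as [He|Hne].
      * apply in_span_log; [exact He|]. apply in_or_app. right. now left.
      * apply in_span_Li with (j - i)%nat; [lia | reflexivity |].
        apply in_or_app. right. right. apply In_polylogs. lia.
  - intros Hjn. split.
    { unfold functions_mid, polylogs. simpl. rewrite length_map, length_seq. lia. }
    apply binom_polylog_sum_span; [lia|]. intros i Hi.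
    (* Here [j - i] runs from 1 to [n]: the value 1 is the logarithm, and no poles arise. *)
    destruct (Nat.eq_dec j (S i)) as [He|Hne].
    + apply in_span_log; [exact He|]. now left.
    + apply in_span_Li with (j - i)%nat; [lia | reflexivity |].
      right. apply In_polylogs. lia.
  - intros Hjn. split.
    { unfold functions_high, polylogs. rewrite length_map, length_seq. lia. }
    apply binom_polylog_sum_span; [lia|]. intros i Hi.
    (* Now [j - i >= j - n >= 2], so only polylogarithms arise. *)
    apply in_span_Li with (j - i)%nat; [lia | reflexivity |].
    apply In_polylogs. lia.
Qed.
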